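(* Let $\mathsf A$ be a Cartan matrix of type $A_n$, $D_n$, $E_6$ or $E_7$, and let $i$ be an index such that $\Lambda_i$ is a dominant minuscule weight. For $b\in B(\Lambda_i)$, the set $\mathcal P(b)$ of paths from $b_{\Lambda_i}$ to $b$ is in one-to-one correspondence with the set of all reduced expressions of $w(b)$ via the map $(i_1,\dots,i_\ell)\mapsto s_{i_1}\cdots s_{i_\ell}$ (where reduced expressions are regarded as words in the simple reflections).
   Context: $I$ is the index set of the simple roots $\alpha_j$, with coroots $h_j$, fundamental weights $\Lambda_j$, and Weyl group $\mathsf W$ generated by $s_j(\lambda)=\lambda-\langle h_j,\lambda\rangle\alpha_j$. A weight $\lambda$ is minuscule if $\langle\alpha^\vee,\lambda\rangle\in\{0,\pm1\}$ for all roots $\alpha$. For $\Lambda_i$ minuscule, the crystal $B(\Lambda_i)$ of the irreducible highest weight $U_q(\mathfrak g)$-module $V(\Lambda_i)$ is identified with the orbit $\mathsf W\cdot\Lambda_i$, each element being its own weight, with $\tilde f_j(\mu)=\mu-\alpha_j$ if $\langle h_j,\mu\rangle=1$ and $\tilde f_j(\mu)=0$ otherwise; the highest weight element is $b_{\Lambda_i}=\Lambda_i$. For $b\in B(\Lambda_i)$, let $\ell=\mathrm{ht}(\Lambda_i-\mathrm{wt}(b))$, where $\mathrm{ht}(\sum k_j\alpha_j)=\sum k_j$, and $\mathcal P(b)=\{(i_1,\dots,i_\ell)\in I^\ell\mid\tilde f_{i_1}\cdots\tilde f_{i_\ell}b_{\Lambda_i}=b\}$. The element $w(b)\in\mathsf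 W$ is defined as $w(b):=s_{i_1}\cdots s_{i_\ell}$ for any $(i_1,\dots,i_\ell)\in\mathcal P(b)$; it does not depend on the choice. *)

(* Defs.v *)
From HB Require Import structures.
From mathcomp Require Import all_boot all_order all_algebra.
From mathcomp Require Import boolp classical_sets functions.
Set Implicit Arguments.
Unset Strict Implicit.
Unset Printing Implicit Defensive.
Import Order.TTheory GRing.Theory Num.Theory.
Local Open Scope classical_set_scope.
Local Open Scope ring_scope.

(** Simply laced Cartan matrices.  Vertices are numbered from 0 in Bourbaki's
    order; [e] lists each edge of the Dynkin diagram once, smaller end first. *)

Definition cartan_of (n : nat) (e : rel nat) : 'M[int]_n :=
  \matrix_(i < n, j < n)
    if i == j then 2 else if e i j || e j i then -1 else 0.

Definition edgeA : rel nat := fun i j => i.+1 == j.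

(* the chain 0 - 1 - ... - (n-2), with n-1 attached to n-3 *)
Definition edgeD (n : nat) : rel nat := fun i j =>
  (i.+1 == j) && (j.+1 < n)%N || (i.+2 == j) && (j.+1 == n).

(* the chain 0 - 2 - 3 - 4 - ... , with 1 attached to 3 *)
Definition edgeE : rel nat := fun i j =>
  [|| (i == 0%N) && (j == 2%N), (i == 1%N) && (j == 3%N)
    | (2 <= i)%N && (i.+1 == j)].

Definition cartan_ADE67 (n : nat) (A : 'M[int]_n) : Prop :=
  [\/ (1 <= n)%N /\ A = cartan_of n edgeA,
      (4 <= n)%N /\ A = cartan_of n (edgeD n),
      n = 6%N /\ A = cartan_of n edgeE
    | n = 7%N /\ A = cartan_of n edgeE].

(** The weight lattice is written in the basis of fundamental weights and the
    coroot lattice in the basis of simple coroots; these bases are dual. *)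

Definition weight (n : nat) := 'rV[int]_n.
Definition coweight (n : nat) := 'rV[int]_n.

Definition pairing (n : nat) (c : coweight n) (la : weight n) : int :=
  \sum_(j < n) c 0 j * la 0 j.

Definition fund_weight (n : nat) (j : 'I_n) : weight n := delta_mx 0 j.
Definition simple_coroot (n : nat) (j : 'I_n) : coweight n := delta_mx 0 j.

(* <h_k, alpha_j> = A k j *)
Definition simple_root (n : nat) (A : 'M[int]_n) (j : 'I_n) : weight n :=
  \row_(k < n) A k j.

Definition refl (n : nat) (A : 'M[int]_n) (j : 'I_n) (la : weight n) :
    weight n :=
  la - pairing (simple_coroot j) la *: simple_root A j.

Definition corefl (n : nat) (A : 'M[int]_n) (j : 'I_n) (c : coweight n) :
    coweight n :=
  c - pairing c (simple_root A j) *: simple_coroot j.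

(* [is_root A al c]: al is a root and c is its coroot.  The roots are the Weyl
   conjugates of the simple roots, and the coroot of w(alpha_j) is w(h_j). *)
Inductive is_root (n : nat) (A : 'M[int]_n) : weight n -> coweight n -> Prop :=
| is_root_simple (j : 'I_n) : is_root A (simple_root A j) (simple_coroot j)
| is_root_refl (j : 'I_n) (al : weight n) (c : coweight n) :
    is_root A al c -> is_root A (refl A j al) (corefl A j c).

Definition dominant (n : nat) (la : weight n) : Prop :=
  forall j : 'I_n, 0 <= pairing (simple_coroot j) la.

Definition minuscule (n : nat) (A : 'M[int]_n) (la : weight n) : Prop :=
  forall (al : weight n) (c : coweight n), is_root A al c ->
    [\/ pairing c la = 0, pairing c la = 1 | pairing c la = -1].

(** The Weyl group, as a group of transformations of the weight lattice. *)

Definition simple_word (n : nat) (A : 'M[int]_n)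
    (u : seq (weight n -> weight n)) : Prop :=
  forall t, t \in u -> exists j : 'I_n, t = refl A j.

Definition word_prod (n : nat) (u : seq (weight n -> weight n)) :
    weight n -> weight n :=
  foldr (fun f g => f \o g) id u.

(* The simple reflections are involutions, so no inverses are needed. *)
Definition weyl (n : nat) (A : 'M[int]_n) : set (weight n -> weight n) :=
  [set w | exists2 u, simple_word A u & word_prod u = w].

Definition reduced_expressions (n : nat) (A : 'M[int]_n)
    (w : weight n -> weight n) : set (seq (weight n -> weight n)) :=
  [set u | [/\ simple_word A u, word_prod u = w &
    forall v, simple_word A v -> word_prod v = w -> (size u <= size v)%N]].

(** The crystal of a minuscule fundamental representation, identified with
    the Weyl orbit of its highest weight; [None] is the zero of the crystal. *)

Definition crystal (n : nat) (A : 'M[int]_n) (i : 'I_n) : set (weight n) :=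
  [set mu | exists2 w, weyl A w & mu = w (fund_weight i)].

Definition crystal_f (n : nat) (A : 'M[int]_n) (j : 'I_n) (mu : weight n) :
    option (weight n) :=
  if pairing (simple_coroot j) mu == 1 then Some (mu - simple_root A j)
  else None.

(* f_{i_1} ( ... (f_{i_l} mu)), the last letter acting first *)
Definition crystal_fs (n : nat) (A : 'M[int]_n) (s : seq 'I_n)
    (mu : weight n) : option (weight n) :=
  foldr (fun j => obind (crystal_f A j)) (Some mu) s.

(* The simple roots are linearly independent when A is invertible, so the set
   has at most one element; the value outside the root lattice is 0. *)
Definition ht (n : nat) (A : 'M[int]_n) (la : weight n) : int :=
  xget 0 [set z | exists2 k : 'I_n -> int,
    la = \sum_(j < n) k j *: simple_root A j & z = \sum_(j < n) k j].

Definition paths (n : nat) (A : 'M[int]_n) (i : 'I_n) (b : weight n) :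
    set (seq 'I_n) :=
  [set s | (size s)%:Z = ht A (fund_weight i - b) /\
           crystal_fs A s (fund_weight i) = Some b].

(* w(b): the product along some path from the highest weight to b *)
Definition path_elt (n : nat) (A : 'M[int]_n) (i : 'I_n) (b : weight n) :
    weight n -> weight n :=
  xget (id : weight n -> weight n)
    [set w | exists2 s, paths A i b s & w = word_prod (map (refl A) s)].

(* Main.v *)
(* All weights of the orbit have coordinates in {0, 1, -1}, so each letter of a
   word changes the height of the weight by at most one.  Hence a word sending
   Lambda_i to b has length at least ht (Lambda_i - b), with equality exactly for
   the paths.  It remains to see that all paths to b give the same element of W,
   and that paths exist: if mu has coordinate -1 at j, then any path to mu can be
   rewritten, using only commutations of orthogonal simple reflections, into one
   whose last step is f_j.  Heights are measured by pairing with 2 rho^vee, whose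
   value on each simple root is 2. *)

Require Import Defs.
From mathcomp Require Import all_boot all_order all_algebra.
From mathcomp Require Import boolp classical_sets functions.
From mathcomp Require Import zify.
Set Implicit Arguments.
Unset Strict Implicit.
Unset Printing Implicit Defensive.
Import Order.TTheory GRing.Theory Num.Theory.
Local Open Scope classical_set_scope.
Local Open Scope ring_scope.

(** * Simply laced Cartan matrices *)

Definition simply_laced (n : nat) (A : 'M[int]_n) : Prop :=
  [/\ forall j, A j j = 2, forall j k, A j k = A k j
    & forall j k, j != k -> A j k = 0 \/ A j k = -1].

Lemma cartan_of_simply_laced n e : simply_laced (cartan_of n e).
Proof.
split=> [j|j k|j k /negPf jk]; rewrite !mxE ?eqxx //.
  by rewrite eq_sym orbC.
by rewrite jk; case: ifP => _; [right | left].
Qed.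

Lemma cartan_ADE67_simply_laced n (A : 'M[int]_n) :
  cartan_ADE67 A -> simply_laced A.
Proof. by case=> [] [_ ->]; exact: cartan_of_simply_laced. Qed.

(** * The coweight 2 rho^vee, type by type *)

Lemma sum_ord_delta n (c : nat -> int) (b : bool) (p : nat) :
  \sum_(m < n) (if b && (m == p :> nat) then c m else 0) =
  if b && (p < n)%N then c p else 0.
Proof.
case: b => /=; last by rewrite big1.
have [pn|np] := ltnP p n; first by rewrite -big_mkcond (big_pred1 (Ordinal pn)).
by rewrite big1 // => m _; have := ltn_ord m; case: eqP => // ->; lia.
Qed.

Lemma pairing_cartan_of n e (c : nat -> int) (j : 'I_n) :
  pairing (\row_(m < n) c m) (simple_root (cartan_of n e) j) =
  2 * c j - \sum_(m < n) (if (m != j :> nat) && (e m j || e j m) then c m else 0).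
Proof.
rewrite /pairing (bigD1 j) //= !mxE eqxx mulrC; congr (_ + _).
rewrite big_mkcond -sumrN; apply: eq_bigr => m _ /=; rewrite !mxE -val_eqE /=.
by case: eqP => //= _; case: ifP; rewrite ?mulr0 ?oppr0 ?mulrN1.
Qed.

(* The coefficients of 2 rho^vee, the sum of the positive coroots, on the simple
   coroots. *)
Definition heightA (n m : nat) : int := m.+1%:Z * (n%:Z - m%:Z).

Definition heightD (n m : nat) : int :=
  if (m.+2 < n)%N then m.+1%:Z * (2 * n%:Z - m.+2%:Z) else 'C(n, 2)%:Z.

Definition heightE6 : nat -> int := nth 0 [:: 16; 22; 30; 42; 30; 16].

Definition heightE7 : nat -> int := nth 0 [:: 34; 49; 66; 96; 75; 52; 27].

(** Brings the neighbour sum into the shape evaluated by [sum_ord_delta], hence the leading [true];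
    the guard [0 < j] is there because [0.-1] is [0]. *)
Lemma neighboursA (m j : nat) (x : int) :
  (if (m != j) && (edgeA m j || edgeA j m) then x else 0) =
  (if true && (m == j.+1) then x else 0)
  + (if (0 < j)%N && (m == j.-1) then x else 0).
Proof. by rewrite /edgeA; do !(case: ifP => ?); lia. Qed.

(** The four terms are the successor along the chain, the vertex n-1 seen from the branching vertex
    n-3, the predecessor along the chain, and n-3 seen from n-1. *)
Lemma neighboursD (n m j : nat) (x : int) :
  (4 <= n)%N -> (m < n)%N -> (j < n)%N ->
  (if (m != j) && (edgeD n m j || edgeD n j m) then x else 0) =
  (if (j.+2 < n)%N && (m == j.+1) then x else 0)
  + (if (j.+3 == n) && (m == j.+2) then x else 0)
  + (if (0 < j < n.-1)%N && (m == j.-1) then x else 0)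
  + (if (j.+1 == n) && (m == j.-2) then x else 0).
Proof. by move=> hn hm hj; rewrite /edgeD; do !(case: ifP => ?); lia. Qed.

(** The quadratic (m+1)(n-m) has second difference -2 and vanishes at m = -1 and m = n, so a
    neighbour missing at an end costs nothing. *)
Lemma heightA_sum (n j : nat) : (j < n)%N ->
  2 * heightA n j -
  ((if true && (j.+1 < n)%N then heightA n j.+1 else 0) +
   (if (0 < j)%N && (j.-1 < n)%N then heightA n j.-1 else 0)) = 2.
Proof.
rewrite /heightA; case: j => [|j] jn /=; do !(case: ifP => [?|/negbT ?]); try lia.
by have -> : n = j.+2; lia.
Qed.

Lemma heightD_sum (n j : nat) : (4 <= n)%N -> (j < n)%N ->
  2 * heightD n j -
  ((if (j.+2 < n)%N && (j.+1 < n)%N then heightD n j.+1 else 0) +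
   (if (j.+3 == n) && (j.+2 < n)%N then heightD n j.+2 else 0) +
   (if (0 < j < n.-1)%N && (j.-1 < n)%N then heightD n j.-1 else 0) +
   (if (j.+1 == n) && (j.-2 < n)%N then heightD n j.-2 else 0)) = 2.
Proof.
(* The binomial coefficient enters the computation only through its double, which is polynomial in
   n. *)
move=> hn jn; have bin_n : 2 * 'C(n, 2)%:Z = n%:Z * (n%:Z - 1).
  by have := mul_bin_diag n 1; rewrite bin1; nia.
rewrite /heightD; move: ('C(n, 2)) bin_n => C bin_n.
(* The two tips of the fork, the branching vertex, and the rest of the chain. *)
have : [\/ n = j.+1, n = j.+2, n = j.+3 | (j.+3 < n)%N].
  have : n = j.+1 \/ n = j.+2 \/ n = j.+3 \/ (j.+3 < n)%N by lia.
  by case=> [|[|[]]]; [constructor 1|constructor 2|constructor 3|constructor 4].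
move=> jN; case: j jn jN => [|[|j]] //= jn jN.
all: case: jN => jN; try (subst n); try (exfalso; lia).
all: repeat (case: ifP => [?|/negbT ?]; try (exfalso; lia)).
all: by rewrite /=; lia.
Qed.

(** Together with [simply_laced], this is all that the proof takes from the classification. *)
Lemma cartan_ADE67_height n (A : 'M[int]_n) : cartan_ADE67 A ->
  exists c : coweight n, forall j, pairing c (simple_root A j) = 2.
Proof.
case=> [] [hn ->].
- exists (\row_(m < n) heightA n m) => j; rewrite pairing_cartan_of.
  under eq_bigr do rewrite neighboursA.
  by rewrite big_split !sum_ord_delta /= heightA_sum.
- exists (\row_(m < n) heightD n m) => j; rewrite pairing_cartan_of.
  under eq_bigr => m _ do rewrite neighboursD //.
  by rewrite !big_split !sum_ord_delta /= heightD_sum.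
- subst n; exists (\row_(m < 6) heightE6 m) => j.
  by rewrite pairing_cartan_of !big_ord_recl big_ord0;
    case: j => [] [|[|[|[|[|[|j]]]]]].
- subst n; exists (\row_(m < 7) heightE7 m) => j.
  by rewrite pairing_cartan_of !big_ord_recl big_ord0;
    case: j => [] [|[|[|[|[|[|[|j]]]]]]].
Qed.

(** * Pairing, reflections and minuscule weights *)

Lemma pairing_coroot n (j : 'I_n) (la : weight n) :
  pairing (simple_coroot j) la = la 0 j.
Proof.
rewrite /pairing (bigD1 j) //= big1 ?addr0 => [|k /negPf jk].
  by rewrite mxE !eqxx mul1r.
by rewrite mxE jk andbF mul0r.
Qed.

Lemma pairingDl n (c c' : coweight n) (la : weight n) :
  pairing (c + c') la = pairing c la + pairing c' la.
Proof.
by rewrite /pairing -big_split; apply: eq_bigr => k _; rewrite mxE mulrDl.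
Qed.

Lemma pairingDr n (c : coweight n) (la mu : weight n) :
  pairing c (la + mu) = pairing c la + pairing c mu.
Proof.
by rewrite /pairing -big_split; apply: eq_bigr => k _; rewrite mxE mulrDr.
Qed.

Lemma pairingZl n a (c : coweight n) (la : weight n) :
  pairing (a *: c) la = a * pairing c la.
Proof. by rewrite mulr_sumr; apply: eq_bigr => k _; rewrite mxE mulrA. Qed.

Lemma pairingZr n a (c : coweight n) (la : weight n) :
  pairing c (a *: la) = a * pairing c la.
Proof. by rewrite mulr_sumr; apply: eq_bigr => k _; rewrite mxE mulrCA. Qed.

Lemma pairing_refl n (A : 'M[int]_n) j (c : coweight n) (la : weight n) :
  pairing c (refl A j la) = pairing (corefl A j c) la.
Proof.
by rewrite /refl /corefl -!scaleNr pairingDl pairingDr pairingZl pairingZr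
  !mulNr [_ * pairing _ la]mulrC.
Qed.

Lemma reflE n (A : 'M[int]_n) j (la : weight n) :
  refl A j la = la - la 0 j *: simple_root A j.
Proof. by rewrite /refl pairing_coroot. Qed.

Lemma refl_inj n (A : 'M[int]_n) : simply_laced A -> injective (refl A).
Proof.
move=> [hd _ _] j k.
(* On [fund_weight j], the reflection s_j turns coordinate j from 1 into -1, while any other s_k
   leaves it at 1. *)
move/(congr1 (fun f : weight n -> weight n => f (fund_weight j) 0 j)).
rewrite !reflE !mxE !eqxx hd /=; have [//|jk] := eqVneq j k.
by rewrite mul0r.
Qed.

Lemma refl_comm n (A : 'M[int]_n) j k (la : weight n) :
  simply_laced A -> A j k = 0 -> refl A j (refl A k la) = refl A k (refl A j la).
Proof.
move=> [_ hs _] jk; rewrite !reflE !mxE (hs k j) jk.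
by rewrite !mulr0 !subr0 addrAC.
Qed.

(** Reflections pass to the coroot side by [pairing_refl], and [is_root] is stable under them. *)
Lemma minuscule_word n (A : 'M[int]_n) (la : weight n) (s : seq 'I_n) :
  minuscule A la -> minuscule A (word_prod (map (refl A) s) la).
Proof.
move=> hm; elim: s => //= j s IH al c hc.
by rewrite pairing_refl; apply: IH (is_root_refl j hc).
Qed.

Lemma minuscule_coord n (A : 'M[int]_n) (la : weight n) j :
  minuscule A la -> [\/ la 0 j = 0, la 0 j = 1 | la 0 j = -1].
Proof. by move=> /(_ _ _ (is_root_simple A j)); rewrite pairing_coroot. Qed.

(** * Paths in the crystal *)

Lemma crystal_fs_cons n (A : 'M[int]_n) j s (la mu : weight n) :
  crystal_fs A (j :: s) la = Some mu <->
  exists nu, [/\ crystal_fs A s la = Some nu, nu 0 j = 1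
               & mu = nu - simple_root A j].
Proof.
rewrite /crystal_fs /=; case: foldr => [nu|] /=; last by split=> // -[? []].
rewrite /crystal_f pairing_coroot; split=> [|[_ [[<-] -> ->]]]; last by rewrite eqxx.
by case: eqP => // e [<-]; exists nu.
Qed.

Lemma crystal_fs_word n (A : 'M[int]_n) s (la mu : weight n) :
  crystal_fs A s la = Some mu -> word_prod (map (refl A) s) la = mu.
Proof.
elim: s mu => [mu [<-] //|j s IH mu /crystal_fs_cons[nu [/IH hs nuj ->]]] /=.
by rewrite hs reflE nuj scale1r.
Qed.

Lemma minuscule_crystal_fs n (A : 'M[int]_n) s (la mu : weight n) :
  minuscule A la -> crystal_fs A s la = Some mu -> minuscule A mu.
Proof. by move=> hm /crystal_fs_word <-; apply: minuscule_word. Qed.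

(* If the path ends with f_k, k <> j, then A j k = -1 would force the coefficient -2
   one step earlier; hence A j k = 0, and f_j commutes past f_k. *)
Lemma path_to_front n (A : 'M[int]_n) (la : weight n) s mu j :
  simply_laced A -> dominant la -> minuscule A la ->
  crystal_fs A s la = Some mu -> mu 0 j = -1 ->
  exists2 t, crystal_fs A t la = Some (mu + simple_root A j) &
    word_prod (map (refl A) s) = refl A j \o word_prod (map (refl A) t).
Proof.
move=> hA hd hm; have [_ hs ho] := hA.
elim: s mu => [mu [<-] laj|k s IH mu /crystal_fs_cons[nu [hnu nuk ->]]].
  (* The empty path ends at [la], where dominance excludes a coordinate -1. *)
  by have := hd j; rewrite pairing_coroot laj.
have [->|/ho jk] := eqVneq j k; first by exists s; rewrite ?subrK.
rewrite !mxE => nuj.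
have Ajk : A j k = 0.
  case: jk => // jk; move: nuj; rewrite jk.
  by case: (minuscule_coord j (minuscule_crystal_fs hm hnu)) => ->.
have /(IH _ hnu)[t ht st] : nu 0 j = -1 by rewrite -nuj Ajk subr0.
exists (k :: t); last by apply/funext => x; rewrite /= st /= (refl_comm _ hA Ajk).
apply/crystal_fs_cons; exists (nu + simple_root A j).
by rewrite !mxE hs Ajk addr0 addrAC.
Qed.

Lemma crystal_fs_last n (A : 'M[int]_n) j s (la mu : weight n) :
  simply_laced A -> crystal_fs A (j :: s) la = Some mu ->
  mu 0 j = -1 /\ crystal_fs A s la = Some (mu + simple_root A j).
Proof.
by move=> [hd _ _] /crystal_fs_cons[nu [hnu nuj ->]]; rewrite subrK !mxE hd nuj.
Qed.

(** Induction on [t]: its head [j], which acts last, leaves coordinate -1 at [j], so [path_to_front]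
    gives a path with the same product as [s] and head [j]; cancel [j] on both sides. *)
Lemma path_word_unique n (A : 'M[int]_n) (la : weight n) s t mu :
  simply_laced A -> dominant la -> minuscule A la ->
  crystal_fs A s la = Some mu -> crystal_fs A t la = Some mu ->
  word_prod (map (refl A) s) = word_prod (map (refl A) t).
Proof.
move=> hA hd hm; elim: t s mu => [|j t IH] s mu hs ht.
  case: s hs => // j s /(crystal_fs_last hA)[]; case: ht => <-.
  by have := hd j; rewrite pairing_coroot => + laj; rewrite laj.
have [muj {}ht] := crystal_fs_last hA ht.
have [s' hs' ->] := path_to_front hA hd hm hs muj.
by rewrite /= (IH _ _ hs' ht).
Qed.

(** According to the coordinate 0, 1 or -1, a further letter [j] keeps the path, prolongs it by f_j,
    or removes an f_j brought to its end by [path_to_front]. *)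
Lemma path_exists n (A : 'M[int]_n) (la : weight n) s :
  simply_laced A -> dominant la -> minuscule A la ->
  exists t, crystal_fs A t la = Some (word_prod (map (refl A) s) la).
Proof.
move=> hA hd hm; elim: s => [|j s [t ht]] /=; first by exists [::].
rewrite reflE; case: (minuscule_coord j (minuscule_word s hm)) => e; rewrite e.
- by exists t; rewrite scale0r subr0.
- exists (j :: t); rewrite scale1r.
  by apply/crystal_fs_cons; exists (word_prod (map (refl A) s) la).
- have [t' ht' _] := path_to_front hA hd hm ht e.
  by exists t'; rewrite scaleN1r opprK.
Qed.

(** * Words in the simple reflections and their heights *)

Lemma simple_word_map n (A : 'M[int]_n) u :
  simple_word A u <-> exists s, u = map (refl A) s.
Proof.
split=> [|[s ->] t /mapP[j _ ->]]; last by exists j.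
elim: u => [_|f u IH hu]; first by exists [::].
have [j ->] := hu f (mem_head _ _).
have [t tu|s ->] := IH; last by exists (j :: s).
by apply: hu; rewrite inE tu orbT.
Qed.

Section Height.
End Height.

(** Each letter lowers the pairing with [c] by 0, 2 or -2, so equality forces every letter to act as
    a crystal operator. *)
Lemma word_height n (A : 'M[int]_n) (c : coweight n) (la : weight n) s :
  (forall j, pairing c (simple_root A j) = 2) -> minuscule A la ->
  let mu := word_prod (map (refl A) s) la in
  pairing c la <= pairing c mu + 2 * (size s)%:Z /\
  (pairing c la = pairing c mu + 2 * (size s)%:Z -> crystal_fs A s la = Some mu).
Proof.
move=> hc hm; elim: s => [|j s [IHle IHeq]] /=; first by rewrite mulr0 addr0.
set mu := word_prod _ la in IHle IHeq *; rewrite reflE.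
case: (minuscule_coord j (minuscule_word s hm)) => e; rewrite -/mu in e; rewrite e.
- by rewrite scale0r subr0; split; lia.
- rewrite scale1r -scaleN1r pairingDr pairingZr hc; split; first by lia.
  move=> eq; have hs : crystal_fs A s la = Some mu by apply: IHeq; lia.
  by apply/crystal_fs_cons; exists mu; rewrite scaleN1r.
- by rewrite scaleN1r opprK pairingDr hc; split; lia.
Qed.

Lemma path_height n (A : 'M[int]_n) (c : coweight n) (la mu : weight n) s :
  (forall j, pairing c (simple_root A j) = 2) ->
  crystal_fs A s la = Some mu -> pairing c la = pairing c mu + 2 * (size s)%:Z.
Proof.
move=> hc; elim: s mu => [mu [<-]|j s IH mu /crystal_fs_cons[nu [/IH -> _ ->]]] /=.
  by rewrite mulr0 addr0.
by rewrite -scaleN1r pairingDr pairingZr hc; lia.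
Qed.

Lemma path_root_sum n (A : 'M[int]_n) (la mu : weight n) s :
  crystal_fs A s la = Some mu ->
  exists k : 'I_n -> int, la - mu = \sum_(j < n) k j *: simple_root A j.
Proof.
elim: s mu => [mu [<-]|j s IH mu /crystal_fs_cons[nu [/IH[k hk] _ ->]]].
  by exists (fun=> 0); rewrite subrr big1 // => j _; rewrite scale0r.
exists (fun m => k m + (m == j)%:R).
under eq_bigr do rewrite scalerDl.
rewrite big_split -hk /= (bigD1 j) //= eqxx scale1r big1 ?addr0 ?opprB => [|m /negPf->].
  by rewrite addrA addrAC.
by rewrite scale0r.
Qed.

Lemma ht_path n (A : 'M[int]_n) (c : coweight n) (la mu : weight n) s :
  (forall j, pairing c (simple_root A j) = 2) ->
  crystal_fs A s la = Some mu -> ht A (la - mu) = size s.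
Proof.
move=> hc hs; have [k hk] := path_root_sum hs.
(* Pairing with [c] doubles the coefficient sum, so every expansion in simple roots has the same
   sum; [path_root_sum] provides one, which rules out the default value of [xget]. *)
have dbl (k' : 'I_n -> int) : la - mu = \sum_(j < n) k' j *: simple_root A j ->
    \sum_(j < n) k' j = size s.
  move=> /(congr1 (pairing c)).
  rewrite -scaleN1r pairingDr pairingZr (path_height hc hs).
  have -> : pairing c (\sum_(j < n) k' j *: simple_root A j) = 2 * \sum_j k' j.
    rewrite mulr_sumr; elim/big_rec2: _ => [|j x y _ <-].
      by rewrite /pairing big1 // => m _; rewrite mxE mulr0.
    by rewrite pairingDr pairingZr hc mulrC.
  by move: (\sum_(j < n) k' j) => x; lia.
rewrite /ht; case: xgetP => [_ _ [k' /dbl <- //]|/(_ (\sum_j k j))[]].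
by exists k.
Qed.

Theorem lemma2p8 (n : nat) (A : 'M[int]_n) (hA : cartan_ADE67 A) (i : 'I_n)
    (hdom : dominant (fund_weight i)) (hmin : minuscule A (fund_weight i))
    (b : weight n) (hb : crystal A i b) :
  set_bij (paths A i b) (reduced_expressions A (path_elt A i b))
          (map (refl A)).
Proof.
have hS := cartan_ADE67_simply_laced hA.
have [c hc] := cartan_ADE67_height hA.
have pathsP s : paths A i b s <-> crystal_fs A s (fund_weight i) = Some b.
  by split=> [[]//|hs]; split=> //; rewrite (ht_path hc hs).
have [p hp] : exists p, paths A i b p.
  case: hb => w [u /simple_word_map[s ->] <-] bE.
  have [t ht] := path_exists s hS hdom hmin.
  by exists t; apply/pathsP; rewrite bE.
have eltE s : paths A i b s -> path_elt A i b = word_prod (map (refl A) s).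
  rewrite /path_elt => hs; case: xgetP => [w _ [t /pathsP ht ->]|].
    exact: path_word_unique hS hdom hmin ht (proj1 (pathsP s) hs).
  by move=> /(_ (word_prod (map (refl A) s)))[]; exists s.
have path_b s : paths A i b s -> path_elt A i b (fund_weight i) = b.
  by move=> hs; rewrite (eltE _ hs); apply: crystal_fs_word; apply/pathsP.
split=> [s hs|s t _ _|u [/simple_word_map[s ->] us umin]].
(* A path is reduced: any word [v] with the same product also sends Lambda_i to [b], so
   [word_height] bounds its length below by that of the path. *)
- split=> [||_ /simple_word_map[v ->] vs]; first by apply/simple_word_map; exists s.
    by rewrite (eltE _ hs).
  have [le_v _] := word_height v hc hmin; move: le_v.
  by rewrite vs (path_b _ hs) !size_map (path_height hc (proj1 (pathsP s) hs)); lia.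
- exact: inj_map (refl_inj hS) _ _.
(* A reduced word is no longer than the path [p], so the bound of [word_height] is attained and the
   word is itself a path. *)
- exists s => //; apply/pathsP.
  have [le_s eq_s] := word_height s hc hmin.
  move: le_s eq_s; rewrite us (path_b _ hp) (path_height hc (proj1 (pathsP p) hp)).
  move=> le_s; apply; have := umin (map (refl A) p).
  rewrite !size_map (eltE _ hp) => /(_ _ erefl).
  have hw : simple_word A (map (refl A) p) by apply/simple_word_map; exists p.
  by move=> /(_ hw); lia.
Qed.
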